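(* Let $K>0$ and $\varphi'(0)>0$ be constants, put $K':=\varphi'(0)K$, and let $h:[0,\infty)\to[0,\infty)$ be nondecreasing and right-continuous. Define the cost function $$C(x):=\frac{K'+\int_0^xh(s)\,\mathrm{d}s}{x},\qquad x>0,$$ and the nondecreasing function $$g(x):=\int_0^x(h(x)-h(s))\,\mathrm{d}s=\int_{(0,x]}t\,h(\mathrm{d}t),\qquad x\geqslant 0 .$$ (i) If $\{x\,|\,g(x)\geqslant K'\}$ is nonempty and $x^*:=\inf\{x\,|\,g(x)\geqslant K'\}$, then $C$ is strictly decreasing on $(0,x^* )$ and nondecreasing on $(x^*,\infty)$, and $C$ attains its minimum over $(0,\infty)$ at $x^*$. (ii) If $\{x\,|\,g(x)\geqslant K'\}$ is empty, then $C$ is strictly decreasing on $(0,\infty)$ and therefore has no finite minimizer.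
   Context: $h(\mathrm{d}t)$ denotes integration with respect to the Lebesgue–Stieltjes measure of $h$ on $(0,\infty)$. In the inventory model, $\varphi'(0)=-\mathbb{E}X_1>0$ for a driving spectrally positive Lévy process $X$ with exponent $\varphi$ ($\mathbb{E}e^{-\alpha X_t}=e^{\varphi(\alpha)t}$), $K$ is the setup cost per order, $h$ is the holding-cost rate of secondary work content, and $C(x)$ is the long-run average total cost when ordering $x$ units of secondary work each time the system empties. The claim uses only the constants $\varphi'(0)$, $K$ and the function $h$. *)

(* Defs.v *)
From HB Require Import structures.
From mathcomp Require Import all_boot all_order all_algebra.
From mathcomp Require Import all_classical all_reals all_analysis.

Set Implicit Arguments.
Unset Strict Implicit.
Unset Printing Implicit Defensive.

Import Order.TTheory GRing.Theory Num.Theory.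
Import numFieldNormedType.Exports.

Local Open Scope classical_set_scope.
Local Open Scope ring_scope.

(* A function on [0, +oo[ is represented by a function R -> R whose values at
   negative points are never used.  *)

Definition nondecreasing_nneg (R : realType) (f : R -> R) : Prop :=
  {in `[0, +oo[ &, {homo f : x y / x <= y}}.

Definition right_continuous_nneg (R : realType) (f : R -> R) : Prop :=
  {in `[0, +oo[, forall x, f y @[y --> x^'+] --> f x}.

(* The cumulative functions of the library live on the whole line: h is
   extended by h 0 on the left, which puts no mass on ]-oo, 0].  *)
Definition extend_left (R : realType) (h : R -> R) (x : R) : R :=
  h (Num.max 0 x).

Lemma extend_left_nondecreasing (R : realType) (h : R -> R) :
  nondecreasing_nneg h -> {homo extend_left h : x y / x <= y}.
Proof.
move=> hnd x y xy; apply: hnd.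
- by rewrite in_itv/= andbT le_max lexx.
- by rewrite in_itv/= andbT le_max lexx.
- by rewrite ge_max !le_max lexx/= xy orbT.
Qed.

Lemma extend_left_right_continuous (R : realType) (h : R -> R) :
  right_continuous_nneg h -> right_continuous (extend_left h).
Proof.
move=> hrc x; rewrite /extend_left; have [x0|x0] := leP 0 x.
  have xr : x \in `[0, +oo[ by rewrite in_itv/= andbT.
  have := hrc _ xr; apply: cvg_trans; apply: near_eq_cvg.
  near=> y; rewrite max_r//; apply: (le_trans x0).
  by apply/ltW; near: y; exact: nbhs_right_gt.
apply: (cvg_trans _ (@cvg_cst _ (h 0) _ (x^'+) _)).
apply: near_eq_cvg; near=> y; rewrite max_l//.
by near: y; exact: nbhs_right_le.
Unshelve. all: by end_near.
Qed.

Definition cumulative_of (R : realType) (h : R -> R)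
    (hnd : nondecreasing_nneg h) (hrc : right_continuous_nneg h) :
    cumulative R R :=
  HB.pack_for (cumulative R R) (extend_left h)
    (isCumulative.Build R _ R (extend_left h)
       (extend_left_nondecreasing hnd) (extend_left_right_continuous hrc)).

Definition cost (R : realType) (K' : R) (h : R -> R) (x : R) : R :=
  (K' + \int[lebesgue_measure]_(s in `[0, x]) h s) / x.

Definition excess (R : realType) (h : R -> R) (x : R) : R :=
  \int[lebesgue_measure]_(s in `[0, x]) (h x - h s).

Definition excess_level (R : realType) (K' : R) (h : R -> R) : set R :=
  [set x | 0 <= x /\ K' <= excess h x].

Definition is_minimizer (R : realType) (f : R -> R) (x : R) : Prop :=
  0 < x /\ forall y : R, 0 < y -> f x <= f y.

(* Main.v *)
Require Import Defs.
From HB Require Import structures.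
From mathcomp Require Import all_boot all_order all_algebra.
From mathcomp Require Import all_classical all_reals all_analysis.
From mathcomp Require Import measurable_realfun.
From mathcomp Require Import lra.

Set Implicit Arguments.
Unset Strict Implicit.

Import Order.TTheory GRing.Theory Num.Theory.
Import numFieldNormedType.Exports.

Local Open Scope classical_set_scope.
Local Open Scope ring_scope.

(** Write H(x) for the integral of h over [0, x].  As h is nondecreasing,

      (y - x) h(x) <= H(y) - H(x) <= (y - x) h(y)    (0 <= x <= y),

    which is [Rintegral_increment_bounds], and g(x) = x h(x) - H(x), which is
    [excessE].  Substituting in C(x) = (K' + H(x)) / x gives

      (y - x) (g(x) - K') <= x y (C(y) - C(x)) <= (y - x) (g(y) - K'),

    which plays the part of C'(x) = (g(x) - K') / x^2 when h is continuous: to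
    the right of a point where g >= K' the cost is at least its value there
    ([cost_le]), and to the left of a point where g < K' the cost is larger
    ([cost_gt]).  As g is nondecreasing, it is below K' before
    x* = inf {g >= K'} and at least K' after it.  Right-continuity of h gives
    g(x* ) >= K' as well ([excess_inf_level]); hence x* > 0, because g(0) = 0,
    and C(x* ) <= C(y) for all y >= x*.  For y < x* the same inequality comes
    from letting w tend to x* from the left in C(w) < C(y)
    ([cost_le_of_left]).

    The identity between g(x) and the integral of t h(dt) over (0, x] is
    Tonelli's theorem on the triangle {0 <= s < t <= x} for ds h(dt): the
    section at t has Lebesgue measure t, the section at s has h(dt)-measure
    h(x) - h(s) ([integral_id_lebesgue_stieltjes]). *)

(** * Integration against a Lebesgue-Stieltjes measure *)

Lemma lebesgue_stieltjes_measure_itvoc (R : realType) (f : cumulative R R)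
    (a b : R) : a <= b ->
  lebesgue_stieltjes_measure f `]a, b]%classic = (f b - f a)%:E.
Proof.
move=> ab; rewrite /lebesgue_stieltjes_measure /measure_extension/=.
by rewrite measurable_mu_extE/= ?wlength_itv_bnd//; exact: is_ocitv.
Qed.

(** Both sides are the measure of [E] for the product of [m1] and [m2]. *)
Lemma integral_measure_sections d1 d2 (T1 : measurableType d1)
    (T2 : measurableType d2) (R : realType)
    (m1 : {sigma_finite_measure set T1 -> \bar R})
    (m2 : {sigma_finite_measure set T2 -> \bar R}) (E : set (T1 * T2)) :
  measurable E ->
  (\int[m1]_x m2 [set y | E (x, y)] = \int[m2]_y m1 [set x | E (x, y)])%E.
Proof.
move=> mE; have := indic_fubini_tonelli m1 m2 mE.
rewrite indic_fubini_tonelli_FE// indic_fubini_tonelli_GE//.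
have -> : m2 \o xsection E = fun x => m2 [set y | E (x, y)].
  by apply/funext => x; rewrite /= xsectionE.
have -> // : m1 \o ysection E = fun y => m1 [set x | E (x, y)].
by apply/funext => y; rewrite /= ysectionE.
Qed.

(** Integration by parts, as the computation of the product measure of the
    triangle [E] along its two families of sections. *)
Lemma integral_id_lebesgue_stieltjes (R : realType) (f : cumulative R R)
    (x : R) :
  (\int[lebesgue_stieltjes_measure f]_(t in `]0%R, x]) t%:E =
   \int[lebesgue_measure]_(s in `[0%R, x]) (f x - f s)%:E)%E.
Proof.
pose E : set (R * R) := [set p | 0 <= p.1 /\ p.1 < p.2 <= x].
have Ey t : lebesgue_measure [set s | E (s, t)]
    = ((EFin \_ `]0, x]) t : \bar R).
  rewrite patchE; case: ifPn => [|tN].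
    rewrite inE/= in_itv/= => /andP[t0 tx].
    rewrite (_ : [set s | _] = `[0, t[%classic).
      by rewrite lebesgue_measure_itv/= lte_fin t0 sube0.
    apply/seteqP; split => s; rewrite /E/= in_itv/= tx andbT.
      by move=> [-> ->].
    by move/andP.
  rewrite (_ : [set s | _] = set0) ?measure0//.
  apply/seteqP; split => // s [/= s0 /andP[st tx]].
  move: tN; rewrite notin_setE/= in_itv/= => /negP.
  by rewrite (le_lt_trans s0 st) tx.
have Ex s : lebesgue_stieltjes_measure f [set t | E (s, t)]
    = (((fun s => (f x - f s)%:E) \_ `[0, x]) s : \bar R).
  rewrite patchE; case: ifPn => [|sN].
    rewrite inE/= in_itv/= => /andP[s0 sx].
    rewrite (_ : [set t | _] = `]s, x]%classic).
      exact: lebesgue_stieltjes_measure_itvoc.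
    by apply/seteqP; split => t; rewrite /E/= in_itv/= s0//; case.
  rewrite (_ : [set t | _] = set0) ?measure0//.
  apply/seteqP; split => // t [/= s0 /andP[st tx]].
  move: sN; rewrite notin_setE/= in_itv/= => /negP.
  by rewrite s0 (le_trans (ltW st) tx).
rewrite integral_mkcond [RHS]integral_mkcond.
under eq_integral do rewrite -Ey.
under [RHS]eq_integral do rewrite -Ex.
apply/esym.
apply: (@integral_measure_sections _ _ (measurableTypeR R) (measurableTypeR R)).
have m1 : measurable_fun [set: R * R] (fun p => (0 <= p.1)%R).
  exact: measurable_fun_ler.
have m2 : measurable_fun [set: R * R] (fun p => (p.1 < p.2)%R).
  exact: measurable_fun_ltr.
have m3 : measurable_fun [set: R * R] (fun p => (p.2 <= x)%R).
  exact: measurable_fun_ler.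
have m := measurable_and m1 (measurable_and m2 m3).
have := m measurableT [set true] I.
rewrite setTI (_ : _ @^-1` _ = E)//.
by apply/seteqP; split => p; rewrite /E/=; [move/andP|move=> [-> ->]].
Qed.

(** * Integrals of a nondecreasing function on the half-line *)

Lemma integrable_cst_itv (R : realType) (i : interval R) (c : R) :
  (lebesgue_measure [set` i] < +oo)%E ->
  lebesgue_measure.-integrable [set` i] (EFin \o cst c).
Proof.
move=> i_fin; apply: measurable_bounded_integrable => //.
by exists `|c|; split => // M cM s _ /=; exact: ltW.
Qed.

Lemma lebesgue_measure_itv_lty (R : realType) (a b : bool) (x y : R) :
  (lebesgue_measure [set` Interval (BSide a x) (BSide b y)] < +oo)%E.
Proof. by rewrite lebesgue_measure_itv/=; case: ifP; rewrite ltry. Qed.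

Lemma nondecreasing_nneg_le (R : realType) (h : R -> R) (x y : R) :
  nondecreasing_nneg h -> 0 <= x -> x <= y -> h x <= h y.
Proof.
move=> h_nd x0 xy; apply: h_nd => //; rewrite in_itv/= andbT//.
exact: le_trans xy.
Qed.

(** Measurability comes from the monotone extension of [h] to the whole line;
    on [0, x] it is [h], whose values there lie between [h 0] and [h x]. *)
Lemma integrable_nondecreasing_nneg (R : realType) (h : R -> R) (x : R) :
  nondecreasing_nneg h -> 0 <= x ->
  lebesgue_measure.-integrable `[0, x] (EFin \o h).
Proof.
move=> h_nd x0.
have h_eq : {in [set` `[0, x]], EFin \o extend_left h =1 EFin \o h}.
  move=> s; rewrite inE/= in_itv/= => /andP[s0 _].
  by rewrite /extend_left/= max_r.
apply: (@eq_integrable _ _ R lebesgue_measure _ _ (EFin \o extend_left h)) => //.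
apply: measurable_bounded_integrable => //.
- exact: lebesgue_measure_itv_lty.
- by apply: nondecreasing_measurable => // s t; exact: extend_left_nondecreasing.
- exists (`|h 0| + `|h x|); split=> // M hM s /=.
  rewrite in_itv/= => /andP[s0 sx]; rewrite /extend_left max_r//.
  apply/ltW/(le_lt_trans _ hM).
  have h0s : h 0 <= h s by exact: nondecreasing_nneg_le.
  have hsx : h s <= h x by exact: nondecreasing_nneg_le.
  rewrite ler_norml; apply/andP; split.
    have := ler_norm (- h 0); rewrite normrN; have := normr_ge0 (h x); lra.
  have := ler_norm (h x); have := normr_ge0 (h 0); lra.
Qed.

Lemma Rintegral_increment_bounds (R : realType) (h : R -> R) (x y : R) :
  nondecreasing_nneg h -> 0 <= x -> x <= y ->
  (y - x) * h x <= \int[lebesgue_measure]_(s in `[0, y]) h s -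
                   \int[lebesgue_measure]_(s in `[0, x]) h s <= (y - x) * h y.
Proof.
move=> h_nd x0 xy; have y0 := le_trans x0 xy.
have ih := integrable_nondecreasing_nneg h_nd y0.
rewrite Rintegral_itvB//.
have ih' : lebesgue_measure.-integrable `]x, y] (EFin \o h).
  by apply: integrableS ih => //; apply: subset_itvr; rewrite bnd_simp.
have cstE c : (y - x) * c = \int[lebesgue_measure]_(s in `]x, y]) c.
  rewrite Rintegral_cst//= lebesgue_measure_itv/= lte_fin mulrC; congr (_ * _).
  by case: ltgtP xy => //= <- _; rewrite subrr.
have icst c : lebesgue_measure.-integrable `]x, y] (EFin \o (fun=> c : R)).
  exact/integrable_cst_itv/lebesgue_measure_itv_lty.
rewrite !cstE; apply/andP; split; apply: le_Rintegral => // s /=;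
  rewrite in_itv/= => /andP[xs sy]; apply: nondecreasing_nneg_le => //.
- exact: ltW.
- exact: le_trans x0 (ltW xs).
Qed.

(** * The excess function *)

Lemma excessE (R : realType) (h : R -> R) (x : R) :
  nondecreasing_nneg h -> 0 <= x ->
  excess h x = x * h x - \int[lebesgue_measure]_(s in `[0, x]) h s.
Proof.
move=> h_nd x0; rewrite /excess RintegralB//; last 2 first.
- exact/integrable_cst_itv/lebesgue_measure_itv_lty.
- exact: integrable_nondecreasing_nneg.
rewrite Rintegral_cst//= lebesgue_measure_itv/= lte_fin mulrC; congr (_ * _ - _).
by case: ltgtP x0 => //=; rewrite oppr0 addr0.
Qed.

(** For [x <= y], the increment of [x * h x - H x] is
    [x * (h y - h x)] plus [(y - x) * h y - (H y - H x)], both nonnegative. *)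
Lemma excess_nondecreasing (R : realType) (h : R -> R) :
  nondecreasing_nneg h -> nondecreasing_nneg (excess h).
Proof.
move=> h_nd x y ix iy xy; have hxy := h_nd _ _ ix iy xy.
move: ix iy; rewrite !in_itv/= !andbT => x0 y0.
rewrite !excessE//.
have /andP[_ ub] := Rintegral_increment_bounds h_nd x0 xy.
have := ler_wpM2l x0 hxy; lra.
Qed.

Lemma excess_lebesgue_stieltjes (R : realType) (h : R -> R)
    (h_nd : nondecreasing_nneg h) (h_rc : right_continuous_nneg h) (x : R) :
  0 <= x ->
  ((excess h x)%:E =
   \int[lebesgue_stieltjes_measure (cumulative_of h_nd h_rc)]_(t in `]0%R, x])
     t%:E)%E.
Proof.
move=> x0; rewrite integral_id_lebesgue_stieltjes.
rewrite /excess /Rintegral fineK.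
  apply: eq_integral => s; rewrite inE/= in_itv/= => /andP[s0 _].
  by rewrite /extend_left !max_r.
apply: integrable_fin_num => //.
have ih := integrable_nondecreasing_nneg h_nd x0.
have icst := integrable_cst_itv (h x) (lebesgue_measure_itv_lty true false 0 x).
by apply: (integrableB _ icst ih).
Qed.

(** * Comparison of costs *)

(** The lower bound on [H y - H x] gives
    [(y - x) * (excess h x - K') <= x * y * (C y - C x)]. *)
Lemma cost_le (R : realType) (K' : R) (h : R -> R) (x y : R) :
  nondecreasing_nneg h -> 0 < x -> x <= y -> K' <= excess h x ->
  cost K' h x <= cost K' h y.
Proof.
move=> h_nd x0 xy; have y0 := lt_le_trans x0 xy.
rewrite excessE ?(ltW x0)// => Kx.
have /andP[lb _] := Rintegral_increment_bounds h_nd (ltW x0) xy.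
rewrite /cost ler_pdivrMr// mulrAC ler_pdivlMr//.
have := ler_wpM2l (ltW x0) lb.
have := ler_wpM2l (etrans (subr_ge0 _ _) xy) Kx.
lra.
Qed.

(** The upper bound on [H y - H x] gives
    [x * y * (C y - C x) <= (y - x) * (excess h y - K')]. *)
Lemma cost_gt (R : realType) (K' : R) (h : R -> R) (x y : R) :
  nondecreasing_nneg h -> 0 < x -> x < y -> excess h y < K' ->
  cost K' h y < cost K' h x.
Proof.
move=> h_nd x0 xy; have y0 := lt_trans x0 xy.
rewrite excessE ?(ltW y0)// => Ky.
have /andP[_ ub] := Rintegral_increment_bounds h_nd (ltW x0) (ltW xy).
rewrite /cost ltr_pdivrMr// mulrAC ltr_pdivlMr//.
have := ler_wpM2l (ltW y0) ub.
have : (y - x) * (y * h y - \int[lebesgue_measure]_(s in `[0, y]) h s)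
    < (y - x) * K' by rewrite ltr_pM2l// subr_gt0.
lra.
Qed.

(** Left-continuity of the cost, in the only form that the minimum requires:
    an upper bound on the left of [x] passes to [x]. *)
Lemma cost_le_of_left (R : realType) (K' c : R) (h : R -> R) (x : R) :
  nondecreasing_nneg h -> 0 < x ->
  (\forall w \near x^'-, cost K' h w <= c) -> cost K' h x <= c.
Proof.
move=> h_nd x0 cw; rewrite /cost ler_pdivrMr//.
(* With the cost at [w] at most [c] and [H x - H w <= (x - w) * h x], the
   numerator of the cost at [x] is at most [c * w + (x - w) * h x = u w]. *)
pose u w := c * x + (x - w) * (h x - c).
have u_cvg : u w @[w --> x^'-] --> u x.
  apply: cvgD; first exact: cvg_cst.
  apply: cvgM; last exact: cvg_cst.
  by apply: cvgB; [exact: cvg_cst|exact: cvg_at_left_filter cvg_id].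
have <- : u x = c * x by rewrite /u subrr mul0r addr0.
apply: (cvgr_to_ge u_cvg); near=> w.
have w0 : 0 < w by near: w; exact: nbhs_left_gt.
have wx : w < x by near: w; exact: nbhs_left_lt.
have : cost K' h w <= c by near: w.
rewrite /cost ler_pdivrMr// => Kw.
have /andP[_] := Rintegral_increment_bounds h_nd (ltW w0) (ltW wx).
rewrite /u; lra.
Unshelve. all: by end_near.
Qed.

(** * The critical point *)

Lemma excess_ge_inf (R : realType) (K' : R) (h : R -> R) (x : R) :
  nondecreasing_nneg h -> excess_level K' h !=set0 ->
  inf (excess_level K' h) < x -> K' <= excess h x.
Proof.
move=> h_nd A0 /(inf_lt A0)[a [a0 Ka] ax]; apply: (le_trans Ka).
apply: nondecreasing_nneg_le a0 (ltW ax); exact: excess_nondecreasing.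
Qed.

Lemma excess_lt_inf (R : realType) (K' : R) (h : R -> R) (x : R) :
  0 <= x -> x < inf (excess_level K' h) -> excess h x < K'.
Proof.
move=> x0; apply: contraTlt => Kx; rewrite -leNgt.
by apply: ge_inf => //; exists 0 => a -[].
Qed.

(** The infimum belongs to the level set because [excess h] inherits
    right-continuity, in the direction that matters, from [h]. *)
Lemma excess_inf_level (R : realType) (K' : R) (h : R -> R) :
  nondecreasing_nneg h -> right_continuous_nneg h ->
  excess_level K' h !=set0 ->
  excess_level K' h (inf (excess_level K' h)).
Proof.
move=> h_nd h_rc A0; set xs := inf _.
have xs0 : 0 <= xs by apply: lb_le_inf => // a -[].
split=> //.
have ixs : xs \in `[0, +oo[ by rewrite in_itv/= xs0.
(* [u y] bounds [excess h y] from above, because [H y - H xs] is at least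
   [(y - xs) * h xs]. *)
pose u y := excess h xs + y * (h y - h xs).
have u_cvg : u y @[y --> xs^'+] --> u xs.
  apply: cvgD; first exact: cvg_cst.
  apply: cvgM; first exact: cvg_at_right_filter cvg_id.
  by apply: cvgB; [exact: h_rc|exact: cvg_cst].
have <- : u xs = excess h xs by rewrite /u subrr mulr0 addr0.
apply: (cvgr_to_ge u_cvg); near=> y.
have xy : xs < y by near: y; exact: nbhs_right_gt.
have y0 := le_trans xs0 (ltW xy).
apply: (le_trans (excess_ge_inf h_nd A0 xy)).
rewrite /u !excessE//.
have /andP[lb _] := Rintegral_increment_bounds h_nd xs0 (ltW xy).
lra.
Unshelve. all: by end_near.
Qed.

Unset Implicit Arguments.
Set Strict Implicit.

Theorem mainTheorem4 (R : realType) (K phi'0 : R) (h : R -> R)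
    (K_gt0 : 0 < K) (phi'0_gt0 : 0 < phi'0)
    (h_ge0 : forall x : R, 0 <= x -> 0 <= h x)
    (h_nd : nondecreasing_nneg h) (h_rc : right_continuous_nneg h) :
  let K' : R := phi'0 * K in
  let C : R -> R := cost K' h in
  let g : R -> R := excess h in
  let A : set R := excess_level K' h in
  [/\ (* g is nondecreasing, and is an integral with respect to h(dt) *)
      nondecreasing_nneg g,
      forall x : R, 0 <= x ->
        (g x)%:E =
        (\int[lebesgue_stieltjes_measure (cumulative_of h_nd h_rc)]_(t in `]0%R, x])
          t%:E)%E,
      (* (i) *)
      A !=set0 ->
        let xs : R := inf A in
        [/\ {in `]0, xs[ &, forall x y : R, x < y -> C y < C x},
            {in `]xs, +oo[ &, forall x y : R, x <= y -> C x <= C y}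
          & is_minimizer C xs]
    & (* (ii) *)
      A = set0 ->
        {in `]0, +oo[ &, forall x y : R, x < y -> C y < C x} /\
        ~ (exists x : R, is_minimizer C x)].
Proof.
move=> K' C g A; have K'0 : 0 < K' by exact: mulr_gt0.
split.
- exact: excess_nondecreasing.
- by move=> x x0; exact: excess_lebesgue_stieltjes.
- move=> A0 xs.
  have [xs0 Kxs] : A xs by exact: excess_inf_level.
  have xs_gt0 : 0 < xs.
    rewrite lt_neqAle xs0 andbT; apply/eqP => xsE; move: Kxs.
    by rewrite -xsE excessE// mul0r set_itv1 Rintegral_set1 subrr leNgt K'0.
  have C_dec : {in `]0, xs[ &, forall x y : R, x < y -> C y < C x}.
    move=> x y; rewrite !in_itv/= => /andP[x0 _] /andP[y0 yxs] xy.
    by apply: cost_gt => //; exact: excess_lt_inf (ltW y0) yxs.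
  split=> //.
    move=> x y; rewrite !in_itv/= !andbT => xsx _ xy.
    apply: cost_le => //; first exact: lt_trans xs_gt0 xsx.
    exact: excess_ge_inf.
  split=> // y y0; have [xsy|yxs] := leP xs y; first exact: cost_le.
  apply: cost_le_of_left => //; near=> w.
  have yw : y < w by near: w; exact: nbhs_left_gt.
  have wxs : w < xs by near: w; exact: nbhs_left_lt.
  by apply/ltW/C_dec; rewrite ?in_itv/= ?y0 ?(lt_trans y0 yw).
- move=> A0.
  have C_dec : {in `]0, +oo[ &, forall x y : R, x < y -> C y < C x}.
    move=> x y; rewrite !in_itv/= !andbT => x0 y0 xy.
    apply: cost_gt => //; rewrite ltNge; apply/negP => Ky.
    by have : A y by [split => //; exact: ltW]; rewrite A0.
  split=> // -[x [x0 x_min]].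
  have x1 : 0 < x + 1 by rewrite addr_gt0.
  have := C_dec x (x + 1); rewrite !in_itv/= !andbT x0 x1 ltrDl ltr01.
  by move=> /(_ isT isT isT); rewrite ltNge x_min.
Unshelve. all: by end_near.
Qed.
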